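(* Let $G=(V,E,W)$ be a finite weighted, undirected, connected graph with positive edge weights, let $e_b\in E$ be a bridge of $G$, and let $G_1,G_2$ be the two connected components obtained by deleting $e_b$ from $G$. Then a maximum minimal cut-set of $G$ can only be obtained on the bridge or on one of the two sides of the bridge: every maximum minimal cut-set $F$ of $G$ is either $\{e_b\}$, or a maximum minimal cut-set of $G_1$, or a maximum minimal cut-set of $G_2$. Moreover, if $F_1$ and $F_2$ are maximum minimal cut-sets of $G_1$ and $G_2$ respectively (a candidate $F_i$ being omitted if $G_i$ is a single vertex), then whichever of $\{e_b\},F_1,F_2$ has the largest cut value is a maximum minimal cut-set of $G$, i.e. $F=\max\{e_b,F_1,F_2\}$, where the maximum is taken with respect to cut value.
   Context: A bridge of a connected graph is an edge whose removal disconnects the graph. Let $H=(V,E,W)$ be a finite undirected connected graph with edge weights in $\mathbb{R}^{+}$ (positive reals). A minimal cut of $H$ is a pair $C=(K,L)$ of disjoint connected subgraphs $K=(V_1,E_1)$, $L=(V_2,E_2)$ of $H$ with $V_1\cup V_2=V$, $V_1\cap V_2=\emptyset$, such that $E$ is the disjoint union of $E_1$, $E_2$ and the set $F$ of edges of $H$ joining $V_1$ to $V_2$, and $F$ is nonempty (so $V_1,V_2$ are nonempty, and $K,L$ are the subgraphs of $H$ induced by $V_1,V_2$). The set $F$ is called the cut-set of $C$, and its cut value is the sum of the weights of the edges in $F$. A maximum minimal cut is a minimal cut of largest cut value among all minimal cuts of $H$, and its cut-set is called a maximum minimal cut-set of $H$. The subgraphs $G_1,G_2$ carry the edge weights inherited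 from $G$. *)

(* Defs.v *)
From HB Require Import structures.
From mathcomp Require Import all_boot all_order all_algebra.
From mathcomp Require Import reals.

Set Implicit Arguments.
Unset Strict Implicit.
Unset Printing Implicit Defensive.

Import Order.TTheory GRing.Theory Num.Theory.

Local Open Scope ring_scope.

(* Finite simple graphs whose vertices are drawn from a common finite type
   [T], so that a graph and its subgraphs, and hence their cut-sets, are
   directly comparable. An edge is the two-element set of its endpoints. The
   well-formedness field is boolean, so that equality of graphs is equality of
   their vertex and edge sets. *)
Record sgraph (T : finType) := SGraph {
  verts : {set T};
  edges : {set {set T}};
  edgesP : [forall e in edges, (e \subset verts) && (#|e| == 2)]
}.

Section Graphs.
Variable T : finType.
Implicit Types (G H K L : sgraph T) (A B : {set T}) (e : {set T}).

Definition adj G : rel T := fun x y => [set x; y] \in edges G.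

Definition connected_graph G : Prop :=
  verts G != set0 /\ {in verts G &, forall x y, connect (adj G) x y}.

Definition subgraph K H : Prop :=
  (verts K \subset verts H) /\ (edges K \subset edges H).

Lemma del_edge_subproof G e :
  [forall f in edges G :\ e, (f \subset verts G) && (#|f| == 2)].
Proof.
apply/forall_inP => f /setD1P[_ fG].
exact: (forall_inP (edgesP G)).
Qed.

Definition del_edge G e : sgraph T := SGraph (del_edge_subproof G e).

Definition bridge G e : Prop :=
  e \in edges G /\ ~ connected_graph (del_edge G e).

Definition component H K : Prop :=
  [/\ subgraph K H,
      connected_graph K
    & forall K', subgraph K' H -> connected_graph K' ->
        subgraph K K' -> K' = K].

Definition edges_between H A B : {set {set T}} :=
  [set e in edges H | [exists x in A, exists y in B, e == [set x; y]]].

Definition cut_set H K L : {set {set T}} :=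
  edges_between H (verts K) (verts L).

Record minimal_cut H K L : Prop := MinimalCut {
  mcut_subl : subgraph K H;
  mcut_subr : subgraph L H;
  mcut_connl : connected_graph K;
  mcut_connr : connected_graph L;
  mcut_verts : verts K :|: verts L = verts H;
  mcut_disj : verts K :&: verts L = set0;
  mcut_edges : edges K :|: edges L :|: cut_set H K L = edges H;
  mcut_edges_disj : [/\ edges K :&: edges L = set0,
                        edges K :&: cut_set H K L = set0
                      & edges L :&: cut_set H K L = set0];
  mcut_neq0 : cut_set H K L != set0
}.

Variable R : realType.
Implicit Types (w : {set T} -> R) (F : {set {set T}}).

(* The weight function is total on sets of vertices and only its values on
   edges matter; a subgraph inherits the weights of the ambient graph by using
   the same [w]. *)
Definition positive_weights w G : Prop := {in edges G, forall e, 0 < w e}.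

Definition cut_value w F : R := \sum_(e in F) w e.

Definition maximum_minimal_cut w H K L : Prop :=
  minimal_cut H K L /\
  forall K' L', minimal_cut H K' L' ->
    cut_value w (cut_set H K' L') <= cut_value w (cut_set H K L).

Definition maximum_minimal_cut_set w H F : Prop :=
  exists K L, maximum_minimal_cut w H K L /\ F = cut_set H K L.

(* The candidate contributed by one side of the bridge: [None] means that it
   is omitted, which is allowed only when that side is a single vertex. *)
Definition side_candidate w H (oF : option {set {set T}}) : Prop :=
  if oF is Some F then maximum_minimal_cut_set w H F
  else #|verts H| = 1%N.

(* [F] has the largest cut value among the members of [s]; in case of a tie
   every maximizer qualifies. *)
Definition largest_cut_value w (s : seq {set {set T}}) F : Prop :=
  F \in s /\ {in s, forall F', cut_value w F' <= cut_value w F}.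

End Graphs.

(* Main.v *)
(* Deleting the bridge [uv] splits the graph into the component of [u] and that
   of [v].  A minimal cut separating [u] from [v] must be these two components,
   because a connected side containing [u] but not [v] cannot cross the bridge.
   Otherwise the side avoiding [u] and [v] lies within one component, and
   intersecting the other side with that component gives a minimal cut of it
   with the same cut-set; this is reversible by attaching the rest of the graph
   to the side meeting the bridge.  So the minimal cut-sets of [G] are exactly
   [{uv}] and the minimal cut-sets of [G1] and of [G2]. *)
Require Import Defs.
From HB Require Import structures.
From mathcomp Require Import all_boot all_order all_algebra.
From mathcomp Require Import reals.

Set Implicit Arguments.
Unset Strict Implicit.
Unset Printing Implicit Defensive.

Import Order.TTheory GRing.Theory Num.Theory.

Local Open Scope ring_scope.

(** * Reachability, induced subgraphs and connected components *)

Section Connectivity.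
Variable T : finType.
Implicit Types (G H K L : sgraph T) (A B : {set T}) (e F : {set {set T}}).

Lemma sgraph_eq G H : verts G = verts H -> edges G = edges H -> G = H.
Proof.
case: G H => [V E p] [V' E' p'] /= eV eE; subst V' E'.
by rewrite (bool_irrelevance p p').
Qed.

Lemma adj_sym G : symmetric (adj G).
Proof. by move=> x y; rewrite /adj setUC. Qed.

Lemma connect_adj_sym G : connect_sym (adj G).
Proof. by apply: sym_connect_sym; apply: adj_sym. Qed.

Lemma edge_sub G f : f \in edges G -> f \subset verts G.
Proof. by move=> fG; have /andP[] := forall_inP (edgesP G) f fG. Qed.

Lemma edge_ends G f : f \in edges G -> exists x y, f = [set x; y].
Proof.
move=> fG; have /andP[_ /cards2P[x [y [_ ->]]]] := forall_inP (edgesP G) f fG.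
by exists x, y.
Qed.

Lemma adj_verts G x y : adj G x y -> x \in verts G /\ y \in verts G.
Proof. by move=> /edge_sub; rewrite subUset !sub1set => /andP[]. Qed.

Lemma connect_adj_mono G H x y : edges G \subset edges H ->
  connect (adj G) x y -> connect (adj H) x y.
Proof.
move=> sGH; apply: connect_sub => a b ab; apply: connect1.
exact: (subsetP sGH).
Qed.

Lemma connected_graph_root G r : r \in verts G ->
  {in verts G, forall x, connect (adj G) x r} -> connected_graph G.
Proof.
move=> rG cr; split; first by apply/set0Pn; exists r.
move=> x y xG yG; apply: connect_trans (cr x xG) _.
by rewrite connect_adj_sym cr.
Qed.

Lemma connect_stable G A x y :
  (forall a b, adj G a b -> a \in A -> b \in A) ->
  connect (adj G) x y -> x \in A -> y \in A.
Proof.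
move=> cA /connectP[p]; elim: p x => [|z p IHp] x /=; first by move=> _ ->.
by move=> /andP[/cA xz pth] yE /xz zA; apply: (IHp z).
Qed.

Lemma induced_subproof G A :
  [forall f in [set f in edges G | f \subset A], (f \subset A) && (#|f| == 2)].
Proof.
apply/forall_inP => f; rewrite inE => /andP[fG ->].
by have /andP[] := forall_inP (edgesP G) f fG.
Qed.

Definition induced G A : sgraph T := SGraph (induced_subproof G A).

Lemma induced_edges G A : edges (induced G A) \subset edges G.
Proof. by apply/subsetP => f; rewrite inE => /andP[]. Qed.

Lemma adj_induced G A x y :
  adj (induced G A) x y = [&& adj G x y, x \in A & y \in A].
Proof. by rewrite /adj inE subUset !sub1set. Qed.

(** A path that starts in a set closed under adjacency never leaves it, so each of its edges
    survives the restriction to [A]. *)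
Lemma connect_induced G A x y :
  (forall a b, adj G a b -> a \in A -> b \in A) ->
  connect (adj G) x y -> x \in A -> connect (adj (induced G A)) x y.
Proof.
move=> cA /connectP[p]; elim: p x => [|z p IHp] x /=; first by move=> _ ->.
move=> /andP[xz pth] yE xA; have zA := cA _ _ xz xA.
apply: (connect_trans (y := z)); last exact: IHp.
by apply: connect1; rewrite adj_induced xz xA zA.
Qed.

(** The reachability class of [x] induces a connected subgraph of [H] containing [K], so the
    maximality of [K] forces equality. *)
Lemma componentE H K x : component H K -> x \in verts K ->
  K = induced H [set y | connect (adj H) x y].
Proof.
move=> [[sV sE] [_ cK] maxK] xK; set C := [set _ | _].
have cC a b : adj H a b -> a \in C -> b \in C.
  by move=> ab; rewrite !inE => xa; apply: connect_trans xa (connect1 ab).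
have xC : x \in C by rewrite inE connect0.
have sKC : verts K \subset C.
  apply/subsetP => y yK; rewrite inE.
  exact: connect_adj_mono sE (cK _ _ xK yK).
apply/esym/maxK.
- split; last exact: induced_edges.
  apply/subsetP => y /=; rewrite inE => xy.
  apply: (@connect_stable H (verts H) x y) => //; last exact: (subsetP sV).
  by move=> a b /adj_verts[].
- apply: (connected_graph_root (r := x)) => // y; rewrite inE => xy.
  by rewrite connect_adj_sym; apply: connect_induced.
- split=> //; apply/subsetP => f fK; rewrite inE (subsetP sE) //=.
  exact: subset_trans (edge_sub fK) sKC.
Qed.

End Connectivity.

(** * Minimal cuts as bipartitions of the vertex set *)

Section Cuts.
Variable T : finType.
Implicit Types (G H K L : sgraph T) (A B : {set T}) (F : {set {set T}}).

Lemma mem_edges_between H A B f : reflect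
  (exists x y, [/\ f = [set x; y], adj H x y, x \in A & y \in B])
  (f \in edges_between H A B).
Proof.
apply: (iffP idP) => [|[x [y [-> xy xA yB]]]].
  rewrite inE => /andP[fH /exists_inP[x xA /exists_inP[y yB /eqP fE]]].
  by exists x, y; split=> //; rewrite /adj -fE.
rewrite inE; apply/andP; split=> //.
by apply/exists_inP; exists x => //; apply/exists_inP; exists y.
Qed.

Lemma edges_betweenC H A B : edges_between H A B = edges_between H B A.
Proof.
apply/setP => f; apply/mem_edges_between/mem_edges_between => -[x [y [-> xy xA yB]]];
  by exists y, x; rewrite setUC adj_sym.
Qed.

Definition minimal_cut_set H F : Prop :=
  exists K L, minimal_cut H K L /\ F = cut_set H K L.

(** A minimal cut encoded by its two vertex sets alone, the subgraphs being recovered as induced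
    ones. In this form cuts can be restricted and extended by set operations. *)
Definition vertex_cut H A B F : Prop :=
  [/\ A :|: B = verts H, [disjoint A & B],
      connected_graph (induced H A), connected_graph (induced H B)
    & F = edges_between H A B /\ F != set0].

Lemma vertex_cutC H A B F : vertex_cut H A B F -> vertex_cut H B A F.
Proof.
move=> [VE dAB cA cB [FE F0]]; split=> //; first by rewrite setUC.
  by rewrite disjoint_sym.
by rewrite edges_betweenC.
Qed.

(** An edge of [L] or of the cut-set has an end in [L], so by disjointness it cannot have both ends
    in [K]; only edges of [K] remain. *)
Lemma minimal_cut_side H K L : minimal_cut H K L -> induced H (verts K) = K.
Proof.
move=> mc; apply: sgraph_eq => //=; apply/setP => f; rewrite inE.
have dKL z : z \in verts K -> z \in verts L -> False.
  by move=> zK zL; have /setP/(_ z) := mcut_disj mc; rewrite !inE zK zL.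
apply/andP/idP => [[fH fK]|fK]; last first.
  split; last exact: edge_sub.
  by have [_ /subsetP->] := mcut_subl mc.
move: (fH); rewrite -(mcut_edges mc) !inE -orbA => /or3P[//|fL|].
  have [x [y fE]] := edge_ends fH.
  have xf : x \in f by rewrite fE !inE eqxx.
  by case: (dKL x); [apply: (subsetP fK)|apply: (subsetP (edge_sub fL))].
move=> /andP[_ /exists_inP[x _ /exists_inP[y yL /eqP fE]]].
by case: (dKL y) => //; apply: (subsetP fK); rewrite fE !inE eqxx orbT.
Qed.

Lemma minimal_cutC H K L : minimal_cut H K L -> minimal_cut H L K.
Proof.
case=> s1 s2 c1 c2 v d e [d1 d2 d3] n.
have cE : cut_set H L K = cut_set H K L by rewrite /cut_set edges_betweenC.
split; rewrite ?cE //; [by rewrite setUC|by rewrite setIC| |].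
  by rewrite [edges L :|: _]setUC.
by split=> //; rewrite setIC.
Qed.

Lemma minimal_cut_setP H F :
  minimal_cut_set H F <-> exists A B, vertex_cut H A B F.
Proof.
split=> [[K [L [mc FE]]]|[A [B [VE dAB cA cB [FE F0]]]]].
  exists (verts K), (verts L); split.
  - exact: mcut_verts mc.
  - by rewrite -setI_eq0; apply/eqP; apply: mcut_disj mc.
  - by rewrite (minimal_cut_side mc); apply: mcut_connl mc.
  - by rewrite (minimal_cut_side (minimal_cutC mc)); apply: mcut_connr mc.
  - by split=> //; rewrite FE; apply: mcut_neq0 mc.
have dis z : z \in A -> z \in B -> False.
  by move=> zA zB; move: (disjointFr dAB zA); rewrite zB.
exists (induced H A), (induced H B); split; last by [].
split=> //=.
- by split; [rewrite -VE subsetUl|apply: induced_edges].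
- by split; [rewrite -VE subsetUr|apply: induced_edges].
- by apply/eqP; rewrite setI_eq0.
- apply/setP => f; apply/idP/idP.
    by rewrite !inE => /orP[/orP[]|] /andP[].
  move=> fH; have [x [y fE]] := edge_ends fH.
  have := edge_sub fH; rewrite -VE fE subUset !sub1set => /andP[].
  rewrite fE in fH *; rewrite !in_setU.
  (* Each edge of [H] is sorted by the sides that contain its two ends. *)
  move=> /orP[] xS /orP[] yS.
  + by rewrite inE fH subUset !sub1set xS yS.
  + by apply/orP; right; apply/mem_edges_between; exists x, y.
  + apply/orP; right; rewrite /cut_set edges_betweenC; apply/mem_edges_between.
    by exists x, y.
  + by rewrite [X in _ || X || _]inE fH subUset !sub1set xS yS orbT.
- split; apply/setP => f; rewrite [RHS]inE in_setI; apply/negP => /andP[].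
  + rewrite !inE => /andP[fH fA] /andP[_ fB].
    have [x [y fE]] := edge_ends fH.
    by move: fA fB; rewrite fE !subUset !sub1set => /andP[xA _] /andP[/(dis _ xA)].
  + rewrite inE => /andP[_ fA] /mem_edges_between[x [y [fE _ _ yB]]].
    by move: fA; rewrite fE subUset !sub1set => /andP[_ /dis]; apply.
  + rewrite inE => /andP[_ fB] /mem_edges_between[x [y [fE _ xA _]]].
    by move: fB; rewrite fE subUset !sub1set => /andP[/(dis _ xA)].
- by rewrite /cut_set /= -FE.
Qed.

(** Both sides of a cut are nonempty and disjoint. This is what justifies omitting the candidate of
    a single-vertex side. *)
Lemma minimal_cut_set_card H F : minimal_cut_set H F -> #|verts H| != 1%N.
Proof.
move=> [K [L [mc _]]].
have [/set0Pn[x xK] _] := mcut_connl mc; have [/set0Pn[y yL] _] := mcut_connr mc.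
apply/negP => /cards1P[z HE]; have := mcut_verts mc; rewrite HE => UE.
have : x \in [set z] by rewrite -UE inE xK.
have : y \in [set z] by rewrite -UE inE yL orbT.
rewrite !inE => /eqP yz /eqP xz; subst x y.
by have /setP/(_ z) := mcut_disj mc; rewrite !inE xK yL.
Qed.

End Cuts.

(** * Splitting a connected graph along a bridge *)

Section Bridge.
Variable T : finType.
Implicit Types (G H : sgraph T) (A B : {set T}) (F : {set {set T}}).

(** Two connected graphs joined by the single edge [uv]. The data are symmetric under exchanging
    [(G1, u)] with [(G2, v)], so later facts are proved for [G1] only. *)
Record bridge_split G G1 G2 (u v : T) : Prop := BridgeSplit {
  bs_u : u \in verts G1;
  bs_v : v \in verts G2;
  bs_verts : verts G1 :|: verts G2 = verts G;
  bs_disj : [disjoint verts G1 & verts G2];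
  bs_edges : edges G = [set u; v] |: (edges G1 :|: edges G2);
  bs_conn1 : connected_graph G1;
  bs_conn2 : connected_graph G2
}.

Lemma bridge_splitC G G1 G2 u v :
  bridge_split G G1 G2 u v -> bridge_split G G2 G1 v u.
Proof.
case=> hu hv V d E c1 c2; split=> //; first by rewrite setUC.
  by rewrite disjoint_sym.
by rewrite E [[set v; u]]setUC [edges G2 :|: _]setUC.
Qed.

Lemma induced_connect_classes H x y : connect (adj H) x y ->
  induced H [set z | connect (adj H) x z] =
  induced H [set z | connect (adj H) y z].
Proof.
move=> xy; congr induced; apply/setP => z; rewrite !inE.
exact: same_connect (connect_adj_sym H) _ _ xy z.
Qed.

Lemma adj_del_edge G eb x y :
  adj (del_edge G eb) x y = ([set x; y] != eb) && adj G x y.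
Proof. by rewrite /adj in_setD1. Qed.

(** The vertices reachable from [u] or [v] after the deletion are closed under adjacency in [G]: the
    deleted edge has both ends among them, and every other edge survives. Connectedness of [G] then
    makes this set exhaust the vertices. *)
Lemma del_edge_cover G eb u v z :
  connected_graph G -> eb \in edges G -> eb = [set u; v] -> z \in verts G ->
  connect (adj (del_edge G eb)) u z || connect (adj (del_edge G eb)) v z.
Proof.
move=> [_ cG] ebG ebE zG; set D := del_edge G eb.
have [uG _] : u \in verts G /\ v \in verts G.
  by apply: adj_verts; rewrite /adj -ebE.
pose S := [set t | connect (adj D) u t || connect (adj D) v t].
suff st : forall a b, adj G a b -> a \in S -> b \in S.
  by have := connect_stable st (cG _ _ uG zG); rewrite !inE connect0; apply.
move=> a b ab; have [abE _|abE] := eqVneq [set a; b] eb.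
  have : b \in eb by rewrite -abE !inE eqxx orbT.
  by rewrite ebE !inE => /orP[] /eqP->; rewrite connect0 ?orbT.
have abD : connect (adj D) a b by apply: connect1; rewrite adj_del_edge abE.
rewrite !inE => /orP[] rb; apply/orP; [left|right];
  exact: connect_trans rb abD.
Qed.

Lemma bridge_split_classes G eb G1 G2 u v :
  connected_graph G -> eb \in edges G -> eb = [set u; v] -> G1 <> G2 ->
  G1 = induced (del_edge G eb) [set z | connect (adj (del_edge G eb)) u z] ->
  G2 = induced (del_edge G eb) [set z | connect (adj (del_edge G eb)) v z] ->
  bridge_split G G1 G2 u v.
Proof.
set D := del_edge G eb => cG ebG ebE G12 G1E G2E.
have [uG vG] : u \in verts G /\ v \in verts G.
  by apply: adj_verts; rewrite /adj -ebE.
have DG z t : adj D z t -> adj G z t by rewrite adj_del_edge => /andP[].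
have classG r z : r \in verts G -> connect (adj D) r z -> z \in verts G.
  move=> rG rz; apply: (connect_stable _ rz rG) => a b /DG.
  by case/adj_verts.
(* If [u] still reached [v], the two classes would coincide, against [G1 <> G2]. *)
have uv : ~~ connect (adj D) u v.
  apply/negP => uv; apply: G12; rewrite G1E G2E.
  exact: induced_connect_classes.
have cover z : z \in verts G -> connect (adj D) u z || connect (adj D) v z.
  exact: del_edge_cover.
have cl r : connected_graph (induced D [set z | connect (adj D) r z]).
  apply: (connected_graph_root (r := r)); first by rewrite inE connect0.
  move=> z; rewrite inE => rz; rewrite connect_adj_sym.
  apply: connect_induced => //; last by rewrite inE connect0.
  by move=> a b ab; rewrite !inE => ra; apply: connect_trans ra (connect1 ab).
split.
- by rewrite G1E inE connect0.
- by rewrite G2E inE connect0.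
- rewrite G1E G2E /=; apply/setP => z; rewrite !inE; apply/idP/idP.
    by move=> /orP[]; apply: classG.
  exact: cover.
- rewrite G1E G2E /= -setI_eq0; apply/eqP/setP => z; rewrite !inE.
  apply/negP => /andP[uz vz]; case/negP: uv.
  by apply: connect_trans uz _; rewrite connect_adj_sym.
- rewrite -ebE G1E G2E; apply/setP => f; apply/idP/idP; last first.
    by rewrite !inE => /orP[/eqP->//|/orP[]/andP[/andP[]]].
  move=> fG; have [x [y fE]] := edge_ends fG.
  rewrite in_setU1 in_setU; have [//|feb] /= := eqVneq f eb.
  (* An edge other than [eb] survives in [D], so its two ends share a class and it belongs to that
     induced side. *)
  have xyD : adj D x y by rewrite adj_del_edge /adj -fE feb.
  have fD : f \in edges D by rewrite fE; exact: xyD.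
  have [xG _] := adj_verts (DG _ _ xyD).
  have fI r : (f \in edges (induced D [set z | connect (adj D) r z])) =
              connect (adj D) r x && connect (adj D) r y.
    by rewrite inE fD fE subUset !sub1set !inE.
  rewrite !fI; case/orP: (cover _ xG) => rx;
    by rewrite rx (connect_trans rx (connect1 xyD)) ?orbT.
- by rewrite G1E.
- by rewrite G2E.
Qed.

(** Every component is the class of one end of [eb]. Distinct components take different ends, and
    the ends are named so that [u] falls in [G1]. *)
Lemma bridge_split_components G eb G1 G2 :
  connected_graph G -> bridge G eb ->
  component (del_edge G eb) G1 -> component (del_edge G eb) G2 -> G1 <> G2 ->
  exists u v, eb = [set u; v] /\ bridge_split G G1 G2 u v.
Proof.
move=> cG [ebG _] h1 h2 G12; have [u [v ebE]] := edge_ends ebG.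
set D := del_edge G eb in h1 h2.
have cls K : component D K ->
    K = induced D [set z | connect (adj D) u z] \/
    K = induced D [set z | connect (adj D) v z].
  move=> hK; have [[sV _] [/set0Pn[x xK] _] _] := hK.
  have xG : x \in verts G by apply: (subsetP sV).
  have := del_edge_cover cG ebG ebE xG.
  rewrite (componentE hK xK).
  by case/orP => /induced_connect_classes->; [left|right].
have [E1|E1] := cls _ h1; have [E2|E2] := cls _ h2.
- by case: G12; rewrite E1 E2.
- by exists u, v; split=> //; apply: (bridge_split_classes cG ebG ebE).
- have ebE' : eb = [set v; u] by rewrite ebE setUC.
  by exists v, u; split=> //; apply: (bridge_split_classes cG ebG ebE').
- by case: G12; rewrite E1 E2.
Qed.

(** * Transfer of cuts between the graph and one side of the bridge *)

Section Split.
Variables (G G1 G2 : sgraph T) (u v : T).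
Hypothesis bs : bridge_split G G1 G2 u v.

Lemma bs_notin2 z : z \in verts G1 -> z \in verts G2 -> False.
Proof. by move=> z1 z2; move: (disjointFr (bs_disj bs) z1); rewrite z2. Qed.

Lemma bs_sub1 : edges G1 \subset edges G.
Proof. by apply/subsetP => f f1; rewrite (bs_edges bs) !inE f1 orbT. Qed.

Lemma bs_adj_uv : adj G u v.
Proof. by rewrite /adj (bs_edges bs) !inE eqxx. Qed.

(** The only way out of [G1] is the bridge, taken from [u] to [v]; all the arguments on one side
    rest on this. *)
Lemma bs_adj1 a b : adj G a b -> a \in verts G1 ->
  adj G1 a b \/ (a = u /\ b = v).
Proof.
rewrite /adj (bs_edges bs) in_setU1 in_setU => /orP[/eqP abE|/orP[ab1|ab2]] a1.
- right.
  have : a \in [set u; v] by rewrite -abE !inE eqxx.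
  have : v \in [set a; b] by rewrite abE !inE eqxx orbT.
  rewrite !inE => /orP[/eqP vE|/eqP vE].
    by case: (bs_notin2 a1); rewrite -vE; apply: bs_v bs.
  move=> /orP[/eqP->|/eqP aE] //.
  by case: (bs_notin2 a1); rewrite aE; apply: bs_v bs.
- by left.
- by have [/(bs_notin2 a1)] := adj_verts ab2.
Qed.

(** A path in [A] from [u] could leave [G1] only by entering [v], which is not in [A]. *)
Lemma connected_side_sub A : connected_graph (induced G A) ->
  u \in A -> v \notin A -> A \subset verts G1.
Proof.
move=> [_ cA] uA vA; apply/subsetP => x xA.
apply: (connect_stable _ (cA _ _ uA xA) (bs_u bs)) => a b.
rewrite adj_induced => /and3P[ab _ bA] /(bs_adj1 ab)[/adj_verts[]//|[_ bE]].
by rewrite -bE bA in vA.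
Qed.

(** A path in [B] could leave [G1] only from [u], which is not in [B]. *)
Lemma connected_avoiding_sub B x : connected_graph (induced G B) ->
  u \notin B -> x \in B -> x \in verts G1 -> B \subset verts G1.
Proof.
move=> [_ cB] uB xB x1; apply/subsetP => y yB.
apply: (connect_stable _ (cB _ _ xB yB) x1) => a b.
rewrite adj_induced => /and3P[ab aB _] /(bs_adj1 ab)[/adj_verts[]//|[aE _]].
by rewrite -aE aB in uB.
Qed.

Lemma bridge_cut : vertex_cut G (verts G1) (verts G2) [set [set u; v]].
Proof.
have conn_side H : edges H \subset edges G -> connected_graph H ->
    connected_graph (induced G (verts H)).
  move=> sE [n0 cH]; split=> // x y xH yH; apply: connect_adj_mono (cH x y xH yH).
  by apply/subsetP => f fH; rewrite inE (subsetP sE) // edge_sub.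
split; [exact: bs_verts bs|exact: bs_disj bs| | |].
- exact: conn_side bs_sub1 (bs_conn1 bs).
- apply: conn_side (bs_conn2 bs).
  by apply/subsetP => f f2; rewrite (bs_edges bs) !inE f2 !orbT.
- split; last by apply/set0Pn; exists [set u; v]; rewrite inE.
  apply/setP => f; rewrite inE; apply/eqP/mem_edges_between => [->|].
    by exists u, v; split; [|exact: bs_adj_uv|exact: bs_u bs|exact: bs_v bs].
  move=> [x [y [-> xy x1 y2]]]; have [/adj_verts[_ y1]|[-> ->]//] := bs_adj1 xy x1.
  by case: (bs_notin2 y1).
Qed.

(** The bridge has no end in [B], so every edge meeting [B] lies in [G1], and so does its other
    end. *)
Lemma edges_between_side A B : B \subset verts G1 -> u \notin B ->
  edges_between G A B = edges_between G1 (A :&: verts G1) B.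
Proof.
move=> B1 uB; apply/setP => f.
apply/mem_edges_between/mem_edges_between => -[x [y [-> xy xA yB]]].
  rewrite adj_sym in xy.
  have [yx|[yE _]] := bs_adj1 xy (subsetP B1 _ yB).
    exists x, y; split=> //; first by rewrite adj_sym.
    by have [_ x1] := adj_verts yx; rewrite inE xA.
  by rewrite -yE yB in uB.
exists x, y; split=> //; first exact: (subsetP bs_sub1).
by move: xA; rewrite inE => /andP[].
Qed.

Lemma connected_induced_side B : B \subset verts G1 -> u \notin B ->
  connected_graph (induced G B) <-> connected_graph (induced G1 B).
Proof.
move=> B1 uB; suff -> : induced G B = induced G1 B by [].
apply: sgraph_eq => //=; apply/setP => f; rewrite !inE.
have [fB|] := boolP (f \subset B); last by rewrite !andbF.
rewrite !andbT; apply/idP/idP => [fG|]; last exact: (subsetP bs_sub1).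
have [x [y fE]] := edge_ends fG; move: fB fG; rewrite fE subUset !sub1set.
move=> /andP[xB _] /bs_adj1 /(_ (subsetP B1 _ xB)) [//|[xE _]].
by rewrite -xE xB in uB.
Qed.

(** Attaching [G2] to the side containing [u] keeps that side connected through the bridge and
    creates no new edge towards [B]. *)
Lemma vertex_cut_extend A B F : vertex_cut G1 A B F -> u \in A ->
  vertex_cut G (A :|: verts G2) B F.
Proof.
move=> [VE dAB [A0 cA] cB [FE F0]] uA.
have A1 : A \subset verts G1 by rewrite -VE subsetUl.
have B1 : B \subset verts G1 by rewrite -VE subsetUr.
have uB : u \notin B by rewrite (disjointFr dAB uA).
have dB2 : [disjoint verts G2 & B].
  by rewrite disjoint_sym; apply: disjointWl B1 (bs_disj bs).
split.
- by rewrite setUAC VE; apply: bs_verts bs.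
- by rewrite -setI_eq0 setIUl setU_eq0 !setI_eq0 dAB.
- apply: (connected_graph_root (r := u)); first by rewrite inE uA.
  have vV : v \in A :|: verts G2 by rewrite inE (bs_v bs) orbT.
  have mono2 x : x \in verts G2 ->
      connect (adj (induced G (A :|: verts G2))) x v.
    have [_ c2] := bs_conn2 bs; move=> x2.
    apply: connect_adj_mono (c2 _ _ x2 (bs_v bs)); apply/subsetP => f f2.
    rewrite inE (bs_edges bs) !inE f2 !orbT /=.
    exact: subset_trans (edge_sub f2) (subsetUr _ _).
  move=> x; rewrite inE => /orP[xA|/mono2 xv].
    apply: connect_adj_mono (cA _ _ xA uA); apply/subsetP => f.
    rewrite !inE => /andP[f1 fA]; rewrite (subsetP bs_sub1) //=.
    exact: subset_trans fA (subsetUl _ _).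
  apply: connect_trans xv (connect1 _).
  by rewrite adj_induced vV adj_sym bs_adj_uv inE uA.
- exact/connected_induced_side.
- split=> //; rewrite edges_between_side // setIUl (setIidPl A1).
  suff -> : verts G2 :&: verts G1 = set0 by rewrite setU0.
  by apply/eqP; rewrite setI_eq0 disjoint_sym; apply: bs_disj bs.
Qed.

(** Intersecting with [G1] keeps [A] connected: a path in [A] towards [u] stays in [G1] until it
    first reaches [u]. *)
Lemma vertex_cut_restrict A B F : vertex_cut G A B F -> u \in A ->
  B \subset verts G1 -> vertex_cut G1 (A :&: verts G1) B F.
Proof.
move=> [VE dAB [A0 cA] cB [FE F0]] uA B1.
have uB : u \notin B by rewrite (disjointFr dAB uA).
have u1 := bs_u bs.
split.
- rewrite setUIl VE (setUidPl B1); apply/setIidPr.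
  by rewrite -(bs_verts bs) subsetUl.
- by apply: disjointWl dAB; apply: subsetIl.
- apply: (connected_graph_root (r := u)); first by rewrite inE uA.
  move=> x; rewrite inE => /andP[xA x1].
  have /connectP[p] := cA _ _ xA uA.
  elim: p x xA x1 => [|y p IHp] x xA x1 /=; first by move=> _ ->.
  rewrite adj_induced => /andP[/and3P[xy _ yA] pth] uE.
  (* A step across the bridge starts at [u], so the target is already reached and the rest of the
     path is dropped. *)
  have [xy1|[-> _]] := bs_adj1 xy x1; last exact: connect0.
  have [_ y1] := adj_verts xy1; apply: connect_trans (IHp y yA y1 pth uE).
  by apply: connect1; rewrite adj_induced xy1 !inE xA x1 yA y1.
- exact/connected_induced_side.
- by split=> //; rewrite FE edges_between_side.
Qed.

Lemma minimal_cut_set_side F : minimal_cut_set G1 F -> minimal_cut_set G F.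
Proof.
move=> /minimal_cut_setP[A [B AB]]; apply/minimal_cut_setP.
have [VE _ _ _ _] := AB; have := bs_u bs; rewrite -VE inE => /orP[] uS.
  by exists (A :|: verts G2), B; apply: vertex_cut_extend.
by exists (B :|: verts G2), A; apply: vertex_cut_extend => //; apply: vertex_cutC.
Qed.

End Split.

Lemma vertex_cut_bridge G G1 G2 u v A B F : bridge_split G G1 G2 u v ->
  vertex_cut G A B F -> u \in A ->
  [\/ F = [set [set u; v]], minimal_cut_set G1 F | minimal_cut_set G2 F].
Proof.
move=> bs AB uA; have bs' := bridge_splitC bs.
have [VE dAB cA cB [FE _]] := AB.
have uB : u \notin B by rewrite (disjointFr dAB uA).
(* If the cut separates [u] from [v], each side is confined to its own component, and covering the
   vertices forces equality. *)
have [vA|vA] := boolP (v \in A); last first.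
  have [uG vG] := adj_verts (bs_adj_uv bs).
  have vB : v \in B by move: vG; rewrite -VE inE (negPf vA).
  have A1 := connected_side_sub bs cA uA vA.
  have B2 := connected_side_sub bs' cB vB uB.
  have AE : A = verts G1.
    apply/eqP; rewrite eqEsubset A1; apply/subsetP => x x1.
    have : x \in A :|: B by rewrite VE -(bs_verts bs) inE x1.
    rewrite inE => /orP[//|/(subsetP B2) x2].
    by case: (bs_notin2 bs x1).
  have BE : B = verts G2.
    apply/eqP; rewrite eqEsubset B2; apply/subsetP => x x2.
    have : x \in A :|: B by rewrite VE -(bs_verts bs) inE x2 orbT.
    rewrite inE => /orP[/(subsetP A1) x1|//].
    by case: (bs_notin2 bs x1).
  by have [_ _ _ _ [-> _]] := bridge_cut bs; rewrite FE AE BE; apply: Or31.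
have vB : v \notin B by rewrite (disjointFr dAB vA).
(* Now [B] avoids both ends of the bridge, so any one of its vertices tells which component contains
   all of [B]. *)
have [/set0Pn[x xB] _] := cB.
have : x \in verts G by rewrite -VE inE xB orbT.
rewrite -(bs_verts bs) inE => /orP[x1|x2].
  apply: Or32; apply/minimal_cut_setP; exists (A :&: verts G1), B.
  apply: (vertex_cut_restrict bs) => //.
  exact: (connected_avoiding_sub bs cB uB xB x1).
apply: Or33; apply/minimal_cut_setP; exists (A :&: verts G2), B.
apply: (vertex_cut_restrict bs') => //.
exact: (connected_avoiding_sub bs' cB vB xB x2).
Qed.

(** With this description, the theorem becomes a comparison of cut values over a union of three
    families. *)
Lemma minimal_cut_set_bridge G G1 G2 u v F : bridge_split G G1 G2 u v ->
  minimal_cut_set G F <->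
  [\/ F = [set [set u; v]], minimal_cut_set G1 F | minimal_cut_set G2 F].
Proof.
move=> bs; split=> [/minimal_cut_setP[A [B AB]]|[->|F1|F2]].
- have [uG _] := adj_verts (bs_adj_uv bs).
  have [VE _ _ _ _] := AB; move: uG; rewrite -VE inE => /orP[] uS.
    exact: (vertex_cut_bridge bs AB uS).
  exact: (vertex_cut_bridge bs (vertex_cutC AB) uS).
- by apply/minimal_cut_setP; exists (verts G1), (verts G2); apply: bridge_cut.
- exact: (minimal_cut_set_side bs F1).
- exact: (minimal_cut_set_side (bridge_splitC bs) F2).
Qed.

End Bridge.

(** * Maximum minimal cut-sets and comparison of the candidates *)

Lemma maximum_minimal_cut_setP (R : realType) (T : finType) (w : {set T} -> R)
    (H : sgraph T) (F : {set {set T}}) :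
  maximum_minimal_cut_set w H F <->
  minimal_cut_set H F /\
  forall F', minimal_cut_set H F' -> cut_value w F' <= cut_value w F.
Proof.
split=> [[K [L [[mc mx] ->]]]|[[K [L [mc FE]]] mx]].
  by split=> [|F' [K' [L' [mc' ->]]]]; [exists K, L|apply: mx].
exists K, L; split=> //; split=> // K' L' mc'.
by rewrite -FE; apply: mx; exists K', L'.
Qed.

Theorem theorem1 (R : realType) (T : finType) (G : sgraph T)
    (w : {set T} -> R) (eb : {set T}) (G1 G2 : sgraph T)
    (hG : connected_graph G)
    (hw : positive_weights w G)
    (hb : bridge G eb)
    (hG1 : component (del_edge G eb) G1)
    (hG2 : component (del_edge G eb) G2)
    (hG12 : G1 <> G2) :
  (forall F : {set {set T}}, maximum_minimal_cut_set w G F ->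
     [\/ F = [set eb],
         maximum_minimal_cut_set w G1 F
       | maximum_minimal_cut_set w G2 F])
  /\
  (forall oF1 oF2 : option {set {set T}},
     side_candidate w G1 oF1 -> side_candidate w G2 oF2 ->
     forall F : {set {set T}},
       largest_cut_value w ([set eb] :: pmap id [:: oF1; oF2]) F ->
       maximum_minimal_cut_set w G F).
Proof.
have [u [v [ebE bs]]] := bridge_split_components hG hb hG1 hG2 hG12.
have cutsE F := minimal_cut_set_bridge F bs.
rewrite -ebE in cutsE.
split=> [F /maximum_minimal_cut_setP[/cutsE mcF mx]|oF1 oF2 s1 s2 F [Fs mx]].
  (* Cut-sets of a side are cut-sets of [G], so a maximum over [G] that lies in one side is a
     maximum there. *)
  case: mcF => [->|F1|F2]; [exact: Or31|apply: Or32|apply: Or33];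
    apply/maximum_minimal_cut_setP; split=> // F' mcF'; apply/mx/cutsE.
  - exact: Or32.
  - exact: Or33.
pose s := [set eb] :: pmap id [:: oF1; oF2].
have memE F' : (F' \in s) = [|| F' == [set eb], oF1 == Some F' | oF2 == Some F'].
  rewrite /s inE mem_pmap map_id !inE; congr (_ || _).
  by rewrite ![Some F' == _]eq_sym.
(* A cut-set of a side is bounded by that side's candidate, hence by [F]; if the candidate is
   omitted, the side is a single vertex and has no cut. *)
have dominated H oF F' : side_candidate w H oF ->
    (forall F0, oF = Some F0 -> F0 \in s) ->
    minimal_cut_set H F' -> cut_value w F' <= cut_value w F.
  case: oF => [F0|] /= sc os mcF'.
    have [_ mx0] := iffLR (maximum_minimal_cut_setP w H F0) sc.
    by apply: le_trans (mx0 _ mcF') (mx _ (os _ erefl)).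
  by have := minimal_cut_set_card mcF'; rewrite sc.
have cut_of H F0 : side_candidate w H (Some F0) -> minimal_cut_set H F0.
  by move=> /= /maximum_minimal_cut_setP[].
apply/maximum_minimal_cut_setP; split.
  apply/cutsE; move: Fs; rewrite -/s memE => /or3P[/eqP|/eqP oE|/eqP oE].
  - exact: Or31.
  - by apply: Or32; apply: cut_of; rewrite -oE.
  - by apply: Or33; apply: cut_of; rewrite -oE.
move=> F' /cutsE[->|F1|F2].
- by apply: mx; rewrite inE eqxx.
- by apply: (dominated G1 oF1) => // F0 oE; rewrite memE oE eqxx orbT.
- by apply: (dominated G2 oF2) => // F0 oE; rewrite memE oE eqxx !orbT.
Qed.
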